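(* The graph of any medium is mediatic.
   Context: A token system is a pair $(\mathcal{S},\mathcal{T})$ where $\mathcal{S}$ is a set of states with $|\mathcal{S}|\ge 2$ and $\mathcal{T}$ is a nonempty set of tokens, each token being a map $\tau:\mathcal{S}\to\mathcal{S}$, $S\mapsto S\tau$, different from the identity. A token $\tilde\tau$ is a reverse of $\tau$ if for all distinct $S,V$: $S\tau=V\iff V\tilde\tau=S$. A message is a finite string $\mathbf{m}=\tau_1\cdots\tau_n$ of tokens acting by $S\mathbf{m}=(\cdots(S\tau_1)\cdots)\tau_n$ (empty message = identity), producing states $S_0=S$, $S_i=S\tau_1\cdots\tau_i$. It is consistent if it does not contain both a token and its reverse; vacuous if $\{1,\dots,n\}$ can be partitioned into pairs $\{i,j\}$ with $\tau_i,\tau_j$ mutual reverses; stepwise effective for $S$ if $S_k\neq S_{k-1}$ for all $k$; concise for $S$ if stepwise effective for $S$, consistent, and no token occurs twice; closed for $S$ if stepwise effective for $S$ and $S\mathbf{m}=S$. A medium is a token system with [M1] for any distinct states $S,V$ some message concise for $S$ transforms $S$ into $V$, and [M2] every message closed for some state is vacuous. The graph of a medium has vertex set $\mathcal{S}$, distinct $S,V$ adjacent iff $S\tau=V$ for some token $\tau$. For a graph with graph distance $\delta$, an arc is an ordered pair $(S,T)$ of adjacent vertices. The relation $\mathcal{L}$ on arcs is defined by $(S,T)\,\mathcal{L}\,(P,Q)$ iff $\delta(S,P)=\delta(T,Q)=\delta(T,P)-1=\delta(S,Q)-1$. A graph is mediatic if it is connected, bipartite, and $\mathcal{L}$ is an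 equivalence relation on its set of arcs. *)

(* Defs.v *)
From mathcomp Require Import all_boot.
From mathcomp Require Import boolp classical_sets.

Set Implicit Arguments.
Unset Strict Implicit.
Unset Printing Implicit Defensive.

Section TokenSystem.
Variable S : Type.
Implicit Types (s v : S) (tau : S -> S) (m : seq (S -> S)) (T : set (S -> S)).

Definition token_system T : Prop :=
  [/\ exists s v, s <> v,
      exists tau, T tau
    & forall tau, T tau -> tau <> id].

(* Both maps are arbitrary; [tau] may be its own reverse, e.g. a swap. *)
Definition reverse tau tau' : Prop :=
  forall s v, s <> v -> (tau s = v <-> tau' v = s).

Definition mutual_reverses tau tau' : Prop :=
  reverse tau tau' /\ reverse tau' tau.

(* Positions are numbered from 0; the default [id] is never reached. *)
Definition token_at m (i : 'I_(size m)) : S -> S := nth id m i.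

Definition message T m : Prop := forall i : 'I_(size m), T (token_at i).

Definition act s m : S := foldl (fun s tau => tau s) s m.

Definition consistent m : Prop :=
  ~ exists i j : 'I_(size m), reverse (token_at i) (token_at j).

Definition vacuous m : Prop :=
  exists P : {set {set 'I_(size m)}},
    finset.partition P [set: 'I_(size m)]%SET /\
    forall B, B \in P ->
      exists i j, [/\ i != j, B = [set i; j]%SET
                    & mutual_reverses (token_at i) (token_at j)].

Definition stepwise_effective s m : Prop :=
  forall k, k < size m -> act s (take k.+1 m) <> act s (take k m).

Definition concise s m : Prop :=
  [/\ stepwise_effective s m, consistent m & injective (@token_at m)].

Definition closed_for s m : Prop := stepwise_effective s m /\ act s m = s.

Record medium := Medium {
  tokens : set (S -> S);
  medium_token_system : token_system tokens;
  medium_M1 : forall s v, s <> v ->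
    exists m, [/\ message tokens m, concise s m & act s m = v];
  medium_M2 : forall m, message tokens m ->
    (exists s, closed_for s m) -> vacuous m
}.

End TokenSystem.

(* Simple undirected graphs, possibly infinite. *)
Record graph (V : Type) := Graph {
  adj :> rel V;
  adj_sym : symmetric adj;
  adj_irr : irreflexive adj
}.

Section MediumGraph.
Variables (S : Type) (M : medium S).

Definition medium_adj : rel S :=
  fun s v => `[< s <> v /\ exists2 tau, tokens M tau & tau s = v >].

Lemma medium_adj_irr : irreflexive medium_adj.
Proof. by move=> s; apply/asboolP => -[]. Qed.

Lemma medium_adj_sym : symmetric medium_adj.
Proof.
suff sub s v : medium_adj s v -> medium_adj v s.
  by move=> s v; apply/idP/idP; apply: sub.
move=> /asboolP[sv [tau Ttau tausv]].
have vs : v <> s by move=> /esym.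
have [m [Tm [effm _ _] mvs]] := medium_M1 M vs.
have Tm' : message (tokens M) (tau :: m).
  by case=> -[|i] Hi //; apply: (Tm (Ordinal (Hi : i < size m))).
have cl : closed_for s (tau :: m).
  split; last by rewrite /act /= tausv.
  move=> [|k] /=; first by rewrite take0 /act /= tausv.
  by rewrite /act /= tausv; apply: effm.
have [P [partP PP]] := medium_M2 Tm' (ex_intro _ s cl).
have /and3P[/eqP covP _ _] := partP.
have : ord0 \in finset.cover P by rewrite covP inE.
move=> /finset.bigcupP[B /PP[i [j [_ -> [rij rji]]]]].
have rev (k : 'I_(size (tau :: m))) :
    reverse tau (token_at k) -> medium_adj v s.
  move=> rk; apply/asboolP; split => //.
  by exists (token_at k); [exact: Tm' | apply/rk].
rewrite finset.in_set2 => /orP[] /eqP e; move: rij rji; rewrite -e => rij rji.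
  exact: rev rij.
exact: rev rji.
Qed.

Definition medium_graph : graph S := Graph medium_adj_sym medium_adj_irr.

End MediumGraph.

Section Mediatic.
Variables (V : Type) (G : graph V).

Definition walk (x y : V) (n : nat) : Prop :=
  exists p : seq V, [/\ path G x p, last x p = y & size p = n].

(* The value is 0 by convention when no walk joins [x] to [y]; this is
   irrelevant in [mediatic], where the graph is also required connected. *)
Definition dist (x y : V) : nat :=
  xget 0 (fun n => walk x y n /\ forall k, walk x y k -> n <= k).

Definition connected_graph : Prop := forall x y, exists n, walk x y n.

Definition bipartite : Prop :=
  exists side : V -> bool, forall x y, G x y -> side x != side y.

Definition arc : Type := {a : V * V | G a.1 a.2}.

(* [x.+1 = y] stands for [x = y - 1], avoiding truncated subtraction. *)
Definition arcL : rel arc := fun a b =>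
  let: (s, t) := sval a in
  let: (p, q) := sval b in
  [&& dist s p == dist t q,
      (dist s p).+1 == dist t p
    & (dist s p).+1 == dist s q].

Definition mediatic : Prop :=
  [/\ connected_graph, bipartite
    & [/\ reflexive arcL, symmetric arcL & transitive arcL]].

End Mediatic.

(* Main.v *)
From mathcomp Require Import all_boot.
From mathcomp Require Import boolp classical_sets.
Require Import Defs.

(** Every token [tau] has a unique reverse [rev_token tau], and M2 says that along
    a closed walk [tau] and its reverse occur equally often.  Comparing two walks
    with the same ends, every token of a concise message occurs in any walk with
    these ends; so the concise messages are exactly the geodesics.  Hence two
    arcs are related by [arcL] iff the same token produces both of them, which is
    an equivalence relation.  Closed walks have even length by M2, so the graph
    is bipartite. *)

Set Implicit Arguments.
Unset Strict Implicit.
Unset Printing Implicit Defensive.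

(** * Reverses of arbitrary maps *)

Lemma reverse_sym S (t u : S -> S) : reverse t u -> reverse u t.
Proof. by move=> r s v sv; have := r v s (nesym sv); tauto. Qed.

(** Where a reverse of [t] moves a point, its value is forced by [t]; where two reverses both fix a
    point, they agree. *)
Lemma reverse_uniq S (t u w : S -> S) : reverse t u -> reverse t w -> u = w.
Proof.
move=> tu tw; apply/funext => s.
have [us|us] := pselect (u s = s); last by apply/esym/(tw _ _ us)/(tu _ _ us).
have [ws|ws] := pselect (w s = s); first by rewrite us ws.
by apply/(tu _ _ ws)/(tw _ _ ws).
Qed.

(** * Effective messages between two states *)

Section Medium.
Variables (S : Type) (M : medium S).
Local Notation token := {classic (S -> S)}.
Implicit Types (s v p q : S) (t u : token) (m n : seq token).

(** Recursion on the message carries both end states, which makes concatenation and reversal plain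
    inductions. *)
Fixpoint effective s m v : Prop :=
  if m is t :: m' then [/\ tokens M t, t s <> s & effective (t s) m' v]
  else s = v.

Lemma effectiveP s m v :
  effective s m v <->
  [/\ message (tokens M) m, stepwise_effective s m & act s m = v].
Proof.
elim: m s => [|t m IH] s /=.
  by split=> [->|[]//]; split=> // -[].
split=> [[Tt ts /IH [Tm em am]]|[Tm em am]].
  split=> //; first by case=> -[|i] Hi //; apply: (Tm (Ordinal (Hi : i < size m))).
  by case=> [|k] /=; [rewrite take0 | apply: em].
split; first exact: (Tm ord0).
  by have := em 0 isT; rewrite /= take0.
apply/IH; split=> // [[i Hi]|k Hk].
  exact: (Tm (Ordinal (Hi : i.+1 < size (t :: m)))).
exact: (em k.+1).
Qed.

Lemma effective_cat s m n v w :
  effective s m v -> effective v n w -> effective s (m ++ n) w.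
Proof.
by elim: m s => [|t m IH] s /= => [->//|[Tt ts e] e']; split=> //; apply: IH.
Qed.

Lemma effective_rcons s m t v :
  effective s m v -> tokens M t -> t v <> v -> effective s (rcons m t) (t v).
Proof. by rewrite -cats1 => e Tt tv; apply: effective_cat e _. Qed.

Lemma closed_vacuous s m : effective s m s -> vacuous m.
Proof.
by move=> /effectiveP[Tm em am]; apply: (medium_M2 Tm); exists s.
Qed.

Lemma exists_concise s v :
  exists m, effective s m v /\ concise s m.
Proof.
have [<-|sv] := pselect (s = v).
  exists [::]; split=> //; split=> //; last by case.
  by case=> -[].
have [m [Tm cm mv]] := medium_M1 M sv.
by exists m; split=> //; apply/effectiveP; case: (cm).
Qed.

Lemma consistentN m t u : consistent m -> t \in m -> reverse t u -> u \notin m.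
Proof.
move=> cm /(nthP (id : token))[i Hi ti] r; apply/negP => /(nthP (id : token))[j Hj uj].
by apply: cm; exists (Ordinal Hi), (Ordinal Hj); rewrite /token_at /= ti uj.
Qed.

(** * The reverse of a token *)

Lemma exists_reverse t : tokens M t ->
  exists u, [/\ tokens M u, reverse t u & u <> t].
Proof.
move=> Tt.
have [s ts] : exists s, t s <> s.
  apply: contrapT => H; have [_ _ /(_ _ Tt)] := medium_token_system M.
  by apply; apply/funext => s; apply: contrapT => ts; apply: H; exists s.
(* Closing the step from [s] to [t s] by a concise message makes [t :: m] vacuous, so the first
   position has a partner, which lies in [m]. *)
have [m [em [_ cm _]]] := exists_concise (t s) s.
have e : effective s (t :: m) s by [].
have /effectiveP[Tm _ _] := e.
have [P [/and3P[/eqP covP _ _] PP]] := closed_vacuous e.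
have [u um r] : exists2 u : token, u \in m & reverse t u.
  have : ord0 \in finset.cover P by rewrite covP inE.
  move=> /finset.bigcupP[B /PP[i [j [ij -> [rij rji]]]]].
  have in_m (k : 'I_(size (t :: m))) : k != ord0 -> (token_at k : token) \in m.
    by case: k => -[|k] //= Hk _; apply: mem_nth.
  rewrite finset.in_set2 => /orP[] /eqP e0.
    by exists (token_at j); [apply: in_m; rewrite e0 eq_sym | move: rij; rewrite -e0].
  by exists (token_at i); [apply: in_m; rewrite e0 | move: rji; rewrite -e0].
exists u; split=> //.
  case/(nthP (id : token)): um => k Hk <-.
  exact: (Tm (Ordinal (Hk : k.+1 < size (t :: m)))).
(* A token equal to its own reverse cannot occur in the consistent message [m]. *)
move=> ut; move: (um); apply/negP.
by apply: (consistentN cm um); move: r; rewrite ut.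
Qed.

Definition rev_token t : token := xget t (fun u => tokens M u /\ reverse t u).

Lemma rev_tokenP t : tokens M t -> tokens M (rev_token t) /\ reverse t (rev_token t).
Proof.
move=> /exists_reverse[u [Tu r _]]; rewrite /rev_token.
by case: xgetP => [w _ //|/(_ u)]; case.
Qed.

Lemma rev_token_reverse t u : tokens M t -> reverse t u -> u = rev_token t.
Proof. by move=> /rev_tokenP[_ r] tu; apply: reverse_uniq tu r. Qed.

Lemma rev_tokenK t : tokens M t -> rev_token (rev_token t) = t.
Proof.
move=> /rev_tokenP[Tr r]; apply/esym/rev_token_reverse => //.
exact: reverse_sym.
Qed.

Lemma rev_token_neq t : tokens M t -> rev_token t != t.
Proof.
move=> Tt; apply/eqP; have [u [_ r]] := exists_reverse Tt.
by rewrite (rev_token_reverse Tt r).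
Qed.

Lemma rev_token_eq t u : tokens M t -> tokens M u ->
  (rev_token t == u) = (t == rev_token u).
Proof.
by move=> Tt Tu; apply/eqP/eqP => [<-|->]; rewrite rev_tokenK.
Qed.

Lemma eqr_rev_token t u : tokens M t -> tokens M u ->
  (rev_token t == rev_token u) = (t == u).
Proof.
by move=> Tt Tu; have [Tr _] := rev_tokenP Tu; rewrite rev_token_eq // rev_tokenK.
Qed.

Lemma rev_tokenE t s : tokens M t -> t s <> s -> rev_token t (t s) = s.
Proof. by move=> /rev_tokenP[_ r] ts; apply/(r _ _ (nesym ts)). Qed.

Lemma effective_tokens s m v t : effective s m v -> t \in m -> tokens M t.
Proof.
elim: m s => [//|u m IH] s /= [Tu _ e]; rewrite inE => /orP[/eqP->//|].
exact: IH e.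
Qed.

(** * Reversed messages and token counts *)

Definition rev_message m := rev (map rev_token m).

Lemma effective_rev s m v : effective s m v -> effective v (rev_message m) s.
Proof.
rewrite /rev_message; elim: m s => [|t m IH] s /= => [->//|[Tt ts /IH e]].
have [Tr _] := rev_tokenP Tt.
rewrite rev_cons -(rev_tokenE Tt ts); apply: effective_rcons => //.
by rewrite rev_tokenE //; apply: nesym.
Qed.

Lemma count_rev_message s m v t : effective s m v -> tokens M t ->
  count_mem t (rev_message m) = count_mem (rev_token t) m.
Proof.
move=> e Tt; rewrite count_rev count_map; apply: eq_in_count => u um /=.
by rewrite rev_token_eq //; apply: effective_tokens e um.
Qed.

(** Each block of the M2 partition holds one token and its reverse, so it contributes equally to
    both counts. *)
Lemma count_closed s m t : effective s m s -> tokens M t ->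
  count_mem t m = count_mem (rev_token t) m.
Proof.
move=> e Tt; have [P [partP PP]] := closed_vacuous e.
have /effectiveP[Tm _ _] := e.
have countE u : count_mem u m =
    \sum_(i in [set: 'I_(size m)]%SET) ((token_at i : token) == u).
  rewrite -sum1_count big_mkcond /= (big_nth (id : token)) big_mkord.
  by apply: eq_big => [i|i _]; [rewrite inE | rewrite /token_at /=; case: eqP].
rewrite !countE !(finset.set_partition_big _ partP) /=.
apply: eq_bigr => B /PP[i [j [ij -> [rij _]]]].
rewrite !big_setU1 ?big_set1 ?inE //= (rev_token_reverse (Tm i) rij).
by rewrite rev_token_eq ?eqr_rev_token //; [rewrite addnC | apply: Tm..].
Qed.

Lemma closed_even s m : effective s m s -> ~~ odd (size m).
Proof.
move=> /closed_vacuous[P [partP PP]].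
rewrite -[size m]card_ord -cardsT (card_uniform_partition _ partP (n := 2)).
  by rewrite muln2 odd_double.
by move=> B /PP[i [j [ij -> _]]]; rewrite cards2 ij.
Qed.

(** Following [m] by the reversal of [n] gives a closed message. Hence the net count of [t], its
    occurrences minus those of its reverse, depends only on the ends; sums avoid subtraction. *)
Lemma count_balance s m n v t :
  effective s m v -> effective s n v -> tokens M t ->
  count_mem t m + count_mem (rev_token t) n =
  count_mem (rev_token t) m + count_mem t n.
Proof.
move=> em en Tt; have [Tr _] := rev_tokenP Tt.
have := count_closed (effective_cat em (effective_rev en)) Tt.
by rewrite !count_cat !(count_rev_message en) // rev_tokenK.
Qed.

(** * Geodesics and graph distance *)

(** This is conciseness with consistency expressed through [rev_token]; minimal length is derived in
    [geodesic_size]. *)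
Definition geodesic s m v :=
  [/\ effective s m v, uniq m & forall t, t \in m -> rev_token t \notin m].

Lemma exists_geodesic s v : exists m, geodesic s m v.
Proof.
have [m [e [_ cm im]]] := exists_concise s v; exists m; split=> //.
  apply/(uniqP (id : token)) => i j; rewrite !inE => Hi Hj ij.
  by case: (im (Ordinal Hi) (Ordinal Hj) ij).
move=> t tm; apply: (consistentN cm tm).
by have [] := rev_tokenP (effective_tokens e tm).
Qed.

(** The net count of [t] is 1 in [m], hence also in [n], so [t] occurs in [n]. *)
Lemma geodesic_sub s m n v :
  geodesic s m v -> effective s n v -> {subset m <= n}.
Proof.
move=> [em um cm] en t tm; have Tt := effective_tokens em tm.
have := count_balance em en Tt.
rewrite (count_uniq_mem _ um) tm (count_memPn (cm _ tm)) add0n add1n => e.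
by rewrite -has_pred1 has_count -e.
Qed.

Lemma geodesic_size s m n v :
  geodesic s m v -> effective s n v -> size m <= size n.
Proof.
by move=> gm en; apply: uniq_leq_size (geodesic_sub gm en); case: gm.
Qed.

Lemma walkP s v k : walk (medium_graph M) s v k <->
  exists2 m, effective s m v & size m = k.
Proof.
split=> [[p [+ <- <-]]|[m + <-]].
  elim: p s => [|w p IH] s /=; first by exists [::].
  case/andP=> /asboolP[sw [t Tt tsw]] /IH[m em <-].
  by exists (t :: m) => //=; rewrite tsw; split=> //; apply: nesym.
elim: m s => [|t m IH] s /= => [->|[Tt ts /IH[p [pp lp <-]]]].
  by exists [::].
exists (t s :: p); split=> //=; rewrite pp andbT.
by apply/asboolP; split; [apply: nesym | exists t].
Qed.

Lemma distE s m v : geodesic s m v -> dist (medium_graph M) s v = size m.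
Proof.
move=> gm; rewrite /dist.
have wm : walk (medium_graph M) s v (size m) by apply/walkP; exists m; case: gm.
have lem k : walk (medium_graph M) s v k -> size m <= k.
  by move=> /walkP[n en <-]; apply: geodesic_size gm en.
(* The default value of [xget] is excluded because [size m] is a minimum. *)
case: xgetP => [k _ [wk lek]|/(_ (size m)) []]; last by split.
by apply/eqP; rewrite eqn_leq lek // lem.
Qed.

(** A concise message with the same ends has all its tokens in [m] and the same size, so [m] is a
    rearrangement of it. *)
Lemma dist_geodesic s m v :
  effective s m v -> dist (medium_graph M) s v = size m -> geodesic s m v.
Proof.
move=> em; have [c gc] := exists_geodesic s v; rewrite (distE gc) => sz.
have cm := geodesic_sub gc em; have [_ uc nc] := gc.
have [_ eqcm] := uniq_min_size uc cm (eq_leq (esym sz)).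
split=> // [|t]; last by rewrite -!eqcm; apply: nc.
by rewrite -(eq_uniq sz eqcm).
Qed.

(* Otherwise [t] occurs twice, net, in [rcons m t], or [rev_token t] does in
   [rev_token t :: m], whereas a geodesic with the same ends uses it at most once. *)
Lemma geodesic_parallel s p m t :
  tokens M t -> t s <> s -> t p <> p -> geodesic s m p ->
  t \notin m /\ rev_token t \notin m.
Proof.
move=> Tt ts tp [em um cm]; have [Tr _] := rev_tokenP Tt.
have nr := rev_token_neq Tt.
split; apply/negP => tm.
- have [c [ec uc _]] := exists_geodesic s (t p).
  have := count_balance (effective_rcons em Tt tp) ec Tt.
  rewrite -cats1 !count_cat /= eqxx (eq_sym t) (negbTE nr) !count_uniq_mem //.
  by rewrite tm (negbTE (cm _ tm)); case: (_ \in c); case: (_ \in c).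
- have [c [ec uc _]] := exists_geodesic (t s) p.
  have e : effective (t s) (rev_token t :: m) p.
    by rewrite /= rev_tokenE //; split=> //; apply: nesym.
  have := count_balance e ec Tt.
  have := cm _ tm; rewrite rev_tokenK // => tNm.
  rewrite /= eqxx (negbTE nr) !count_uniq_mem // tm (negbTE tNm).
  by case: (_ \in c); case: (_ \in c).
Qed.

(** * Arcs and the tokens producing them *)

Local Notation d := (dist (medium_graph M)).

Lemma arc_token_dist s p t u :
  tokens M t -> tokens M u -> t s <> s -> u p <> p ->
  [&& d s p == d (t s) (u p), (d s p).+1 == d (t s) p
    & (d s p).+1 == d s (u p)] = (t == u).
Proof.
move=> Tt Tu ts up; have [Tr _] := rev_tokenP Tt.
have [m gm] := exists_geodesic s p; have [em um cm] := gm.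
have [n gn] := exists_geodesic (t s) (u p); have [en un cn] := gn.
have e1 := effective_rcons em Tu up.
have e2 : effective (t s) (rev_token t :: m) p.
  by rewrite /= rev_tokenE //; split=> //; apply: nesym.
rewrite (distE gm) (distE gn); apply/and3P/eqP => [[/eqP dn /eqP d2 /eqP d1]|tu].
  have g3 : geodesic s (t :: n) (u p).
    by apply: dist_geodesic; rewrite //= -dn -d1.
  have [_ _ c2] : geodesic (t s) (rev_token t :: m) p.
    by apply: dist_geodesic; rewrite //= -d2.
  (* The geodesic [t :: n] forces [t] into [rcons m u]; [t] is not in [m], since [rev_token t :: m]
     is a geodesic too, so [t] is [u]. *)
  have := geodesic_sub g3 e1 (mem_head t n).
  rewrite mem_rcons inE => /orP[/eqP//|tm].
  have := c2 _ (mem_head _ _).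
  by rewrite rev_tokenK // inE tm orbT.
subst u; have [tNm rNm] := geodesic_parallel Tt ts up gm.
have nr := rev_token_neq Tt.
have g1 : geodesic s (rcons m t) (t p).
  split=> // [|u]; first by rewrite rcons_uniq tNm.
  rewrite !mem_rcons !inE negb_or => /orP[/eqP->|um']; first by rewrite nr.
  rewrite cm // andbT rev_token_eq //; last exact: effective_tokens em um'.
  by apply: contraNneq rNm => <-.
have g2 : geodesic (t s) (rev_token t :: m) p.
  split=> // [|u]; first by rewrite /= rNm.
  rewrite !inE negb_or => /orP[/eqP->|um'].
    by rewrite rev_tokenK // eq_sym nr.
  rewrite cm // andbT eqr_rev_token //.
    by apply: contraNneq tNm => <-.
  exact: effective_tokens em um'.
(* Seen from the other side, [rev_token t] moves both ends of [n], so [n] contains neither [t] nor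
   its reverse. *)
have [] := @geodesic_parallel (t s) (t p) n (rev_token t) Tr _ _ gn.
- by rewrite rev_tokenE //; apply: nesym.
- by rewrite rev_tokenE //; apply: nesym.
rewrite rev_tokenK // => rNn tNn.
rewrite (distE g1) (distE g2) size_rcons /= !eqxx; split=> //.
(* One inequality compares [t :: n] with the geodesic [rcons m t]. For the other, [n] draws its
   tokens from [rev_token t], [m] and [t], hence from [m] alone. *)
rewrite eqn_leq -ltnS -(size_rcons m t) (geodesic_size g1 (n := t :: n)) //=.
apply: uniq_leq_size un _ => u un'.
have := geodesic_sub gn (effective_rcons e2 Tt up) un'.
rewrite mem_rcons !inE => /or3P[/eqP ut|/eqP ut|//].
  by move: tNn; rewrite -ut un'.
by move: rNn; rewrite -ut un'.
Qed.

Lemma exists_arc_token (a : arc (medium_graph M)) : exists t,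
  [/\ tokens M t, t (sval a).1 = (sval a).2 & t (sval a).1 <> (sval a).1].
Proof.
case: a => -[s v] /= /asboolP[sv [t Tt tsv]].
by exists t; split=> //; rewrite tsv; apply: nesym.
Qed.

Definition arc_token (a : arc (medium_graph M)) : token :=
  projT1 (cid (exists_arc_token a)).

(** The equivalence laws of [arcL] thereby reduce to those of equality of tokens. *)
Lemma arcLE a b : @arcL _ (medium_graph M) a b = (arc_token a == arc_token b).
Proof.
rewrite /arc_token; case: cid => t [Tt]; case: cid => u [Tu].
rewrite /arcL; case: a b => -[s v] ? [[p q] ?] /= <- up <- ts.
exact: arc_token_dist.
Qed.

(** * Connectedness and bipartiteness *)

Lemma medium_connected : connected_graph (medium_graph M).
Proof.
move=> s v; have [m [em _ _]] := exists_geodesic s v.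
by exists (size m); apply/walkP; exists m.
Qed.

Lemma medium_bipartite : bipartite (medium_graph M).
Proof.
have [[s _] _ _] := medium_token_system M.
(* The sides are the parities of the distance from a base state [s]. *)
exists (fun x => odd (d s x)) => x y /asboolP[xy [t Tt txy]].
have [m gm] := exists_geodesic s x; have [n gn] := exists_geodesic s y.
rewrite (distE gm) (distE gn).
have e : effective s (rcons m t) y.
  by rewrite -txy; apply: effective_rcons; rewrite ?txy //; [case: gm | apply: nesym].
have [/effective_rev en _ _] := gn.
(* Going to [x], applying [t] and returning from [y] is closed, so [size m + 1 + size n] is even. *)
have := closed_even (effective_cat e en).
rewrite size_cat size_rcons size_rev size_map oddD /=.
by case: (odd _); case: (odd _).
Qed.

End Medium.

Theorem theorem12p3 (S : Type) (M : medium S) : mediatic (medium_graph M).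
Proof.
split; [exact: medium_connected | exact: medium_bipartite | split].
- by move=> a; rewrite arcLE.
- by move=> a b; rewrite !arcLE eq_sym.
- by move=> b a c; rewrite !arcLE => /eqP->.
Qed.
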